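(* Let $G$ be a $k$-uniform parsimonious game with $h$ types, i.e. a parsimonious game with free type representation $(k,k,\ldots,k)$ (with $h-1$ components). Then the minimal winning quota of $G$ is $F_h(k)$, the $h$-th $k$-Fibonacci number.
   Context: A constant sum homogeneous weighted majority game on a finite player set $N$ is a simple game ($v(S)\in\{0,1\}$ for every $S\subseteq N$), constant sum ($v(S)+v(N\setminus S)=1$), admitting a (unique) minimal homogeneous representation $(q,\mathbf{w})$: the individual weights $w_j$ are integers in nondecreasing order, some players have weight $1$, $v(S)=1$ if and only if $w(S):=\sum_{j\in S}w_j\ge q$, with $q=\frac{1+w(N)}{2}$, and $w(S)=q$ for every minimal winning coalition $S$ (a coalition with $v(S)=1$ and $v(T)=0$ for all $T\subsetneq S$). The number $q$ is the minimal winning quota of the game. A parsimonious game ($P$ game) is a constant sum homogeneous weighted majority game with $n>3$ players, none of them dummy, having exactly $n$ minimal winning coalitions (the smallest possible number). Recalled facts about $P$ games (known, due to earlier work). Group the players by equal weight in the minimal homogeneous representation into $h$ types ($2\le h\le n-2$) with type weights $w_1<w_2<\cdots<w_h$, and let $x_t\geq 1$ be the number of players of type $t$. Then $x_1>1$, $x_{h-1}>1$, $x_h=1$. The vector $(x_1,\ldots,x_h)$ is the type representation, and $(x_1,\ldots,x_{h-1})$ is the free type representation; it determines the game. With the convention $w_0=0$, the type weights satisfy $w_1=1$, $w_t=x_{t-1}w_{t-1}+w_{t-2}$ for $1<t<h$, and $w_h=(x_{h-1}-1)w_{h-1}+w_{h-2}$. A $P$ game is $k$-uniform if $x_t=k=\frac{n-1}{h-1}$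 for all $t=1,\ldots,h-1$. For a positive integer $k$, the $k$-Fibonacci sequence is defined by $F_0(k)=0$, $F_1(k)=1$, $F_m(k)=k\,F_{m-1}(k)+F_{m-2}(k)$ for $m\ge2$. *)

(* Defs.v *)
From mathcomp Require Import all_boot.

Set Implicit Arguments.
Unset Strict Implicit.
Unset Printing Implicit Defensive.

(* A simple game on n players: v(S) in {0,1} is encoded as a boolean, which
   coerces to nat in arithmetic expressions. *)
Definition simple_game (n : nat) := {set 'I_n} -> bool.

Definition constant_sum (n : nat) (v : simple_game n) : Prop :=
  forall S : {set 'I_n}, v S + v (~: S) = 1.

Definition minimal_winning (n : nat) (v : simple_game n) (S : {set 'I_n}) : bool :=
  v S && [forall T : {set 'I_n}, (T \proper S) ==> ~~ v T].

Definition coalition_weight (n : nat) (w : 'I_n -> nat) (S : {set 'I_n}) : nat :=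
  \sum_(j in S) w j.

(* The fourth clause is q = (1 + w(N)) / 2 with the denominator cleared, so
   that no truncated division is involved. *)
Definition minimal_homogeneous_representation (n : nat) (v : simple_game n)
    (q : nat) (w : 'I_n -> nat) : Prop :=
  [/\ forall i j : 'I_n, i <= j -> w i <= w j,
      exists j : 'I_n, w j = 1,
      forall S : {set 'I_n}, v S = (q <= coalition_weight w S),
      2 * q = 1 + coalition_weight w [set: 'I_n]
    & forall S : {set 'I_n}, minimal_winning v S -> coalition_weight w S = q].

Definition constant_sum_homogeneous (n : nat) (v : simple_game n) : Prop :=
  constant_sum v /\
  exists (q : nat) (w : 'I_n -> nat), minimal_homogeneous_representation v q w.

Definition dummy (n : nat) (v : simple_game n) (i : 'I_n) : Prop :=
  forall S : {set 'I_n}, minimal_winning v S -> i \notin S.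

Definition parsimonious (n : nat) (v : simple_game n) : Prop :=
  [/\ constant_sum_homogeneous v,
      3 < n,
      forall i : 'I_n, ~ dummy v i
    & #|[set S : {set 'I_n} | minimal_winning v S]| = n].

(* The type weights w_1 < ... < w_h: the distinct individual weights, sorted. *)
Definition type_weights (n : nat) (w : 'I_n -> nat) : seq nat :=
  sort leq (undup (codom w)).

Definition num_types (n : nat) (w : 'I_n -> nat) : nat := size (type_weights w).

(* (x_1, ..., x_h), where x_t is the number of players of weight w_t. *)
Definition type_representation (n : nat) (w : 'I_n -> nat) : seq nat :=
  [seq #|[set j : 'I_n | w j == a]| | a <- type_weights w].

(* (x_1, ..., x_(h-1)) *)
Definition free_type_representation (n : nat) (w : 'I_n -> nat) : seq nat :=
  take (num_types w).-1 (type_representation w).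

(* x_t = k for all t < h, and k = (n-1)/(h-1) as an exact quotient.  The second
   clause excludes h = 1 as soon as n > 1. *)
Definition uniform_types (n : nat) (w : 'I_n -> nat) (k : nat) : Prop :=
  free_type_representation w = nseq (num_types w).-1 k /\
  k * (num_types w).-1 = n.-1.

Fixpoint kfib (k m : nat) : nat :=
  match m with
  | 0 => 0
  | 1 => 1
  | (m'.+1 as m1).+1 => k * kfib k m1 + kfib k m'
  end.

(* Main.v *)
(* In such a game the minimal winning coalitions are the coalitions of weight
   exactly q, and a winning coalition can be trimmed to weight q by deleting
   its lightest players.  Hence, if S has weight q and i is in S, the complement
   of S together with i, minus an initial segment of weight w i - 1, has weight
   q again.  These exchanges determine the weights, so the n incidence vectors
   of the minimal winning coalitions are linearly independent; in particular no
   two of them separate the same ordered pair of equal players.  This forces a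
   minimal winning coalition that contains some but not all of the players of a
   type to contain exactly one of them, and to be all-or-nothing on the other
   types.  Applying the exchange to such coalitions yields the linear recursion
   of the type weights, hence w_t = F_t(k) for t < h, and the coalition mixing
   the type h - 1 consists of one of its players and the heaviest player, which
   gives q. *)
Require Import Defs.
From mathcomp Require Import all_boot.
From mathcomp Require Import all_algebra zify.

Set Implicit Arguments.
Unset Strict Implicit.
Unset Printing Implicit Defensive.

Import GRing.Theory.

(** * Trimming and exchange in a homogeneous game *)

Section HomogeneousGame.

Variables (n : nat) (w : 'I_n -> nat) (q : nat).

Local Notation wt := (coalition_weight w).

Hypothesis w_gt0 : forall i, 0 < w i.
Hypothesis quota : 2 * q = 1 + wt [set: 'I_n].
Hypothesis homogeneous : forall S : {set 'I_n},
  q <= wt S -> (forall i, i \in S -> wt (S :\ i) < q) -> wt S = q.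
Hypothesis no_dummy : forall i, exists2 S : {set 'I_n}, wt S = q & i \in S.

Lemma wt_subset (S T : {set 'I_n}) : S \subset T -> wt S <= wt T.
Proof.
move=> sST; rewrite /coalition_weight [leqRHS](big_setID S) /=.
by rewrite (setIidPr sST) leq_addr.
Qed.

Lemma wtD (S T : {set 'I_n}) : T \subset S -> wt S = wt T + wt (S :\: T).
Proof. by move=> sTS; rewrite /coalition_weight (big_setID T) /= (setIidPr sTS). Qed.

Lemma wtD1 (S : {set 'I_n}) i : i \in S -> wt S = w i + wt (S :\ i).
Proof. by move=> iS; rewrite /coalition_weight (big_setD1 i). Qed.

Lemma wtU1 (S : {set 'I_n}) i : i \notin S -> wt (i |: S) = w i + wt S.
Proof. by move=> iS; rewrite /coalition_weight big_setU1. Qed.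

Lemma wtC (S : {set 'I_n}) : wt S + wt (~: S) = 2 * q - 1.
Proof.
have := wtD (subsetT S); rewrite setTD => e.
by rewrite -e quota addKn.
Qed.

Lemma wt_le (S : {set 'I_n}) i : i \in S -> w i <= wt S.
Proof. by move=> iS; rewrite (wtD1 iS) leq_addr. Qed.

Lemma quota_gt0 : 0 < q.
Proof. by case: q quota. Qed.

Lemma swap_wt (S : {set 'I_n}) i j :
  i \in S -> j \notin S -> w i = w j -> wt (j |: (S :\ i)) = wt S.
Proof.
by move=> iS jS e; rewrite wtU1 ?(wtD1 iS) ?e // !inE negb_and jS orbT.
Qed.

(** Lightest players are deleted as long as the coalition still wins. Once deleting a lightest one
    makes it lose, so does deleting any other, and homogeneity gives weight [q]. *)
Lemma trim_winning (S : {set 'I_n}) : q <= wt S ->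
  exists R : {set 'I_n}, [/\ R \subset S, wt (S :\: R) = q &
    {in R & S :\: R, forall l m, w l <= w m}].
Proof.
have [m] := ubnP #|S|; elim: m S => // m IH S cS qS.
have [S0|[x xS]] := set_0Vmem S.
  by move: qS quota_gt0; rewrite S0 /coalition_weight big_set0; lia.
pose i := [arg min_(i < x in S) w i].
have [iS imin] : i \in S /\ {in S, forall j, w i <= w j}.
  by rewrite /i; case: arg_minnP.
have [qi|iq] := leqP q (wt (S :\ i)).
  have [|R [sR wR dR]] := IH (S :\ i) _ qi.
    by move: cS; rewrite (cardsD1 i) iS.
  have eR : S :\: (i |: R) = (S :\ i) :\: R by rewrite setDDl.
  exists (i |: R); split; rewrite ?eR //.
    by rewrite subUset sub1set iS (subset_trans sR) ?subD1set.
  move=> l j /setU1P[->|lR] jS; last exact: dR.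
  by apply: imin; move: jS; rewrite !inE => /and3P[].
exists set0; rewrite setD0; split; rewrite ?sub0set //; last first.
  by move=> l j; rewrite inE.
apply: homogeneous => // j jS.
by have := imin j jS; have := wtD1 jS; have := wtD1 iS; lia.
Qed.

(** The complement of [S] weighs [q - 1], so adding [i] creates an excess of [w i - 1], which is
    trimmed. Player [i] survives, since without it at most [q - 1] remains. *)
Lemma exchange (S : {set 'I_n}) i : wt S = q -> i \in S ->
  exists R : {set 'I_n}, [/\ R \subset ~: S, wt R + 1 = w i,
    wt ((i |: ~: S) :\: R) = q &
    {in R & (i |: ~: S) :\: R, forall l m, w l <= w m}].
Proof.
move=> qS iS; have iC : i \notin ~: S by rewrite inE iS.
have wi0 := w_gt0 i; have q0 := quota_gt0.
have wC := wtC S; have wiC := wtU1 iC.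
have [|R [sR wR dR]] := @trim_winning (i |: ~: S); first by lia.
have wD := wtD sR.
have iR : i \notin R.
  apply/negP => iR.
  suff : wt ((i |: ~: S) :\: R) <= wt (~: S) by lia.
  apply/wt_subset/subsetP => l; rewrite !inE => /andP[lR /orP[/eqP el|//]].
  by rewrite el iR in lR.
exists R; split=> //; last by lia.
apply/subsetP => l lR; have := subsetP sR l lR.
by case/setU1P => // el; rewrite el (negPf iR) in lR.
Qed.

Lemma flip (S : {set 'I_n}) i : wt S = q -> i \in S -> w i = 1 ->
  wt (i |: ~: S) = q.
Proof.
move=> qS iS wi.
by have := wtC S; have := quota_gt0; rewrite wtU1 ?inE ?iS //; lia.
Qed.

Lemma mix_exists i j : i != j -> w i = w j ->
  exists S : {set 'I_n}, [/\ wt S = q, i \in S & j \notin S].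
Proof.
move=> ij eij; have [S qS iS] := no_dummy i.
have [jS|jS] := boolP (j \in S); last by exists S.
have [R [sR _ wD _]] := exchange qS iS.
exists ((i |: ~: S) :\: R); split=> //.
  by rewrite !inE eqxx andbT; apply/negP => /(subsetP sR); rewrite inE iS.
by rewrite !inE eq_sym (negPf ij) jS andbF.
Qed.

(** Let [j] be lightest among the players other than [p]. In the exchange at [j], from a coalition
    containing both, the removed players avoid [p], so each weighs at least [w j]; their total is
    [w j - 1], hence there are none. *)
Lemma lightest_twin p : 1 < n -> w p = 1 -> exists2 p', p' != p & w p' = 1.
Proof.
move=> n1 p1.
have [x xp] : exists x, x != p.
  have : 0 < #|[set~ p]| by rewrite cardsC1 card_ord; lia.
  by case/card_gt0P => x; rewrite !inE => xp; exists x.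
pose j := [arg min_(j < x | j != p) w j].
have [jp jmin] : j != p /\ forall l, l != p -> w j <= w l.
  by rewrite /j; case: arg_minnP.
have [S [qS pS jS]] : exists S : {set 'I_n}, [/\ wt S = q, p \in S & j \in S].
  have [S qS pS] := no_dummy p; have [jS|jS] := boolP (j \in S); first by exists S.
  by exists (p |: ~: S); rewrite flip // !inE eqxx jS orbT.
have [R [sR wR _ _]] := exchange qS jS.
exists j => //; have [R0|[l lR]] := set_0Vmem R.
  by move: wR; rewrite R0 /coalition_weight big_set0.
have lp : l != p by apply: contraTneq pS => <-; have := subsetP sR l lR; rewrite inE.
by have := jmin l lp; have := wt_le lR; lia.
Qed.

(** * Linear independence of the coalitions of weight [q] *)

Local Open Scope ring_scope.

(** With [c] the total of [y], exchanges give [y j = - c * w j] by strong induction on [w j];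
    summing over one coalition of weight [q] then forces [c = 0]. *)
Lemma weights_separate (y : 'I_n -> rat) :
  (forall S : {set 'I_n}, wt S = q -> \sum_(l in S) y l = 0) ->
  forall l, y l = 0.
Proof.
move=> y0; pose c := \sum_l y l.
have yC (S : {set 'I_n}) : wt S = q -> \sum_(l in ~: S) y l = c.
  move=> qS; rewrite /c [RHS](bigID (mem S)) /= (y0 S) // add0r.
  by apply: eq_bigl => l; rewrite inE.
have yw j : y j = - c * (w j)%:R.
  have [m] := ubnP (w j); elim: m j => // m IH j wjm.
  have [S qS jS] := no_dummy j.
  have [R [sR wR wD _]] := exchange qS jS.
  have jR : j \notin R by apply/negP => /(subsetP sR); rewrite inE jS.
  have jC : j \notin ~: S by rewrite inE jS.
  have := y0 _ wD.
  have : \sum_(l in j |: ~: S) y l = y j + c by rewrite big_setU1 ?yC.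
  rewrite (big_setID R) /= (setIidPr _); last first.
    by rewrite (subset_trans sR) ?subsetUr.
  move=> + e; rewrite e addr0 => eR.
  have eRw : \sum_(l in R) y l = - c * (wt R)%:R.
    rewrite /coalition_weight natr_sum mulr_sumr; apply: eq_bigr => l lR.
    by apply: IH; have := wt_le lR; lia.
  by rewrite -wR natrD mulrDr mulr1 -eRw eR addrK.
suff c0 : c = 0 by move=> l; rewrite yw c0 oppr0 mul0r.
have [S qS] : exists S, wt S = q.
  case: (pickP (@predT 'I_n)) => [i _|n0].
    by have [S] := no_dummy i; exists S.
  have w0 S : wt S = 0%N by rewrite /coalition_weight big1 // => i; have := n0 i.
  by exists set0; move: quota; rewrite !w0; lia.
have := y0 _ qS; under eq_bigr => l _ do rewrite yw.
rewrite -mulr_sumr -natr_sum -/(wt S) qS => /eqP.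
by rewrite mulf_eq0 Num.Theory.pnatr_eq0 oppr_eq0 eqn0Ngt quota_gt0 orbF => /eqP.
Qed.

Hypothesis few : #|[set S : {set 'I_n} | wt S == q]| = n.

(* The incidence matrix is square, and injective on columns by
   [weights_separate]; hence its rows are linearly independent. *)
Lemma swap_unique (S T : {set 'I_n}) i j : i != j -> w i = w j ->
  wt S = q -> wt T = q -> i \in S -> j \notin S -> i \in T -> j \notin T ->
  S = T.
Proof.
move=> ij eij qS qT iS jS iT jT.
pose M := [set S : {set 'I_n} | wt S == q].
pose A : 'M[rat]_(#|M|, n) := \matrix_(s < #|M|, l < n) (l \in enum_val s)%:R.
have fA : row_free A.
  suff : row_free A^T by rewrite /row_free mxrank_tr => /eqP->; rewrite few.
  rewrite -kermx_eq0.
  apply/rowV0P => y /sub_kermxP yA.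
  suff y0 : forall l, y 0 l = 0 by apply/rowP => l; rewrite y0 mxE.
  apply: weights_separate => U qU.
  have UM : U \in M by rewrite inE qU.
  have /rowP/(_ (enum_rank_in UM U)) := yA; rewrite !mxE.
  under eq_bigr => l _ do rewrite !mxE enum_rankK_in //.
  move=> e; rewrite -[RHS]e big_mkcond /=; apply: eq_bigr => l _.
  by case: (l \in U); rewrite ?mulr1 ?mulr0.
pose S' := j |: (S :\ i); pose T' := j |: (T :\ i).
have qS' : wt S' = q by rewrite swap_wt.
have qT' : wt T' = q by rewrite swap_wt.
(* Swapping [i] for [j] changes the incidence vectors of [S] and [T] by the same amount, so [u] is a
   linear relation between the rows. Its entry at [S] is 1 unless [S = T]. *)
pose u : 'rV[rat]_#|M| := \row_s ((enum_val s == S)%:R + (enum_val s == T')%:R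
   - (enum_val s == T)%:R - (enum_val s == S')%:R).
have delta (U : {set 'I_n}) l : wt U = q ->
    \sum_(s < #|M|) (enum_val s == U)%:R * (l \in enum_val s)%:R = (l \in U)%:R :> rat.
  move=> qU; have UM : U \in M by rewrite inE qU.
  rewrite (bigD1 (enum_rank_in UM U)) //= enum_rankK_in // eqxx mul1r.
  rewrite big1 ?addr0 // => s sU; case: eqP => [e|_]; last by rewrite mul0r.
  by case/eqP: sU; apply: enum_val_inj; rewrite enum_rankK_in.
have uA : u *m A = 0.
  apply/rowP => l; rewrite !mxE.
  under eq_bigr => s _ do rewrite !mxE !mulrBl mulrDl.
  rewrite !sumrB big_split /= !delta // !inE.
  have [->|lj] := eqVneq l j; first by rewrite (negPf jS) (negPf jT) add0r subr0 subrr.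
  have [->|li] := eqVneq l i; first by rewrite iS iT addr0 !subr0 subrr.
  by rewrite /= addrK subrr.
have SM : S \in M by rewrite inE qS.
have : u = 0 by apply: (row_free_inj fA); rewrite uA mul0mx.
move/rowP/(_ (enum_rank_in SM S)); rewrite !mxE enum_rankK_in // eqxx.
have [//|_] := eqVneq S T.
have /negPf-> : S != T' by apply: contraNneq jS => ->; rewrite !inE eqxx.
have /negPf-> : S != S' by apply: contraNneq jS => ->; rewrite !inE eqxx.
by rewrite addr0 !subr0 => /eqP; rewrite oner_eq0.
Qed.


(* Coalitions separating equal players *)
Local Close Scope ring_scope.

(** Otherwise, replacing [i'] by [j'] in [S] would give a second coalition of weight [q] separating
    [i] from [j]. *)
Lemma mix_unique (S : {set 'I_n}) i i' j j' : wt S = q ->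
  i \in S -> j \notin S -> w i = w j -> i' \in S -> j' \notin S -> w i' = w j' ->
  i != i' -> j = j'.
Proof.
move=> qS iS jS eij i'S j'S eij' ii'; apply/eqP/negPn/negP => jj'.
have ij : i != j by apply: contraNneq jS => <-.
have jT : j \notin j' |: (S :\ i').
  by rewrite !inE negb_or jj' negb_and jS orbT.
have iT : i \in j' |: (S :\ i') by rewrite !inE ii' iS orbT.
have qT : wt (j' |: (S :\ i')) = q by rewrite swap_wt.
have e := swap_unique ij eij qS qT iS jS iT jT.
by move: j'S; rewrite e setU11.
Qed.

Variable z : 'I_n.
Hypothesis z_top : forall i, i != z -> w i < w z.
Hypothesis twin : forall i, i != z -> exists2 j, j != i & w j = w i.

Lemma twin_top i j : i != j -> w i = w j -> i != z.
Proof.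
by move=> ij eij; apply: contraNneq ij => iz; apply: contraT => ji;
  have := z_top (i := j); rewrite -iz eq_sym ji eij ltnn => /(_ isT).
Qed.

(* If [i] were not alone, its complement, completed by [i] and trimmed, would
   be a second minimal winning coalition separating [i] from another player of
   [S]; the two are told apart by [z]. *)
Lemma mix_sole (S : {set 'I_n}) i j i' : wt S = q ->
  i \in S -> j \notin S -> w i = w j -> i' \in S -> w i' = w i -> i' = i.
Proof.
move=> qS iS jS eij i'S ei'; apply/eqP/negPn/negP => i'i.
have [R [sR wR wD _]] := exchange qS iS.
have small l : w i <= w l -> l \notin R.
  by move=> il; apply/negP => /wt_le; lia.
have ii' : i != i' by rewrite eq_sym.
have iz := twin_top ii' (esym ei').
have i'j : i' != j by apply: contraNneq jS => <-.
have i'z : i' != z by apply: (twin_top i'i).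
have jz : j != z by apply: (@twin_top j i); rewrite // eq_sym; apply: contraNneq jS => <-.
have := @swap_unique ((i |: ~: S) :\: R) (j |: (S :\ i')) i i' ii' (esym ei') wD.
rewrite swap_wt ?ei' //.
have zR : z \notin R by apply: small; apply/ltnW/z_top.
rewrite !inE !eqxx small // iS (negPf i'i) i'S (negPf i'j) ii' /= andbF orbT.
move=> /(_ qS isT isT isT isT)/setP/(_ z).
rewrite !inE zR (eq_sym z) (negPf iz) (eq_sym z) (negPf jz) (eq_sym z) i'z /=.
by case: (z \in S).
Qed.

(** Suppose [l] is lighter than [r], and trim [r |: S]. If [r] goes, it goes alone, although the
    lighter [l] is kept. If [r] stays, the result separates [r] from an equal and still separates
    [i] from [j], against [mix_unique]. *)
Lemma mix_lower (S : {set 'I_n}) i j r l : wt S = q ->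
  i \in S -> j \notin S -> w i = w j -> r \notin S -> w r < w i ->
  l \in S -> w r <= w l.
Proof.
move=> qS iS jS eij rS ri lS; rewrite leqNgt; apply/negP => lr.
have rz : r != z.
  by apply: contraTneq ri => ->; have [->|/z_top] := eqVneq i z; lia.
have [r' r'r er'] := twin rz.
have r'S : r' \notin S.
  apply/negP => r'S; have ir' : i != r' by apply: contraTneq ri => ->; rewrite er' ltnn.
  have jr := mix_unique qS iS jS eij r'S rS er' ir'.
  by move: ri; rewrite eij jr ltnn.
have wrS := wtU1 rS.
have [|R [sR wD dR]] := @trim_winning (r |: S); first by lia.
have wR : wt R = w r by have := wtD sR; lia.
have [rR|rR] := boolP (r \in R).
  have lR : l \notin R.
    apply/negP => lR.
    have /eqP := wtD1 rR; rewrite wR -{1}[w r]addn0 eqn_add2l eq_sym => /eqP R0.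
    have lnr : l != r by apply: contraTneq lr => ->; rewrite ltnn.
    have : l \in R :\ r by rewrite !inE lnr.
    by move/wt_le; rewrite R0 leqNgt w_gt0.
  have := dR r l rR; by rewrite !inE lR lS orbT leqNgt lr => /(_ isT).
have iR : i \notin R by apply/negP => /wt_le; rewrite wR leqNgt ri.
have ir : i != r by apply: contraTneq ri => ->; rewrite ltnn.
have jr : j != r by apply: contraTneq ri => <-; rewrite eij ltnn.
have jr' : j = r'.
  apply: (@mix_unique ((r |: S) :\: R) i r j r') => //; rewrite !inE.
  - by rewrite iR iS orbT.
  - by rewrite (negPf jr) (negPf jS) andbF.
  - by rewrite rR eqxx.
  - by rewrite (negPf r'r) (negPf r'S) andbF.
by move: ri; rewrite eij jr' er' ltnn.
Qed.

(** * The recursion of the type weights and the quota *)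

Variables p p' : 'I_n.
Hypothesis pp' : p != p'.
Hypothesis p1 : w p = 1.
Hypothesis p'1 : w p' = 1.

(* There are [n - 1] minimal winning coalitions in which some player is
   separated from an equal, one for each player but [z]. *)
Lemma unmixed_unique : exists2 E : {set 'I_n},
  (forall l, w l = 1 -> l \in E) &
  forall D : {set 'I_n}, wt D = q ->
    (forall i j, w i = w j -> i \in D -> j \in D) -> D = E.
Proof.
have [S [qS pS p'S]] := mix_exists pp' (etrans p1 (esym p'1)).
have epp' : w p = w p' by rewrite p1.
(* [S] separates two players of weight 1, and [p] is the only one of them that it contains; every
   other type is all-or-nothing in [S], so [E] separates no equals. *)
pose E := p |: ~: S.
have qE : wt E = q by apply: flip.
have E1 l : w l = 1 -> l \in E.
  move=> l1; rewrite !inE; case: (boolP (l \in S)) => [lS|]; last by rewrite orbT.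
  by rewrite (mix_sole qS pS p'S epp' lS) ?eqxx // p1.
have unmixE i j : w i = w j -> i \in E -> j \in E.
  move=> eij iE; apply: contraT => jE.
  have jS : j \in S by apply: contraR jE; rewrite !inE => ->; rewrite orbT.
  have jp : p != j by apply: contraNneq jE => <-; rewrite !inE eqxx.
  have := iE; rewrite !inE => /orP[/eqP ip|iS].
    by rewrite E1 // -eij ip in jE.
  have ip' := mix_unique qS pS p'S epp' jS iS (esym eij) jp.
  by rewrite E1 // -eij -ip' in jE.
exists E => // D qD unmixD.
pose sep i (U : {set 'I_n}) :=
  [&& wt U == q, i \in U & [exists j, (j \notin U) && (w i == w j)]].
(* The default [E] of [odflt] is never reached, since each player but [z] has an equal. Only [z] is
   sent to [E], so [f] enumerates all coalitions of weight [q]. *)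
pose f i := if i == z then E else odflt E [pick U | sep i U].
have sepf i : i != z -> sep i (f i).
  rewrite /f => /[dup] iz /negPf->; case: pickP => //= none.
  have [j ji eji] := twin iz.
  have ij : i != j by rewrite eq_sym.
  have [U [qU iU jU]] := mix_exists ij (esym eji).
  have := none U; rewrite /sep qU eqxx iU /=.
  by move/existsP => []; exists j; rewrite jU eji eqxx.
have unsep i : ~~ sep i E.
  apply/negP => /and3P[_ iE /existsP[j /andP[jE /eqP eij]]].
  by rewrite (unmixE i j) in jE.
have f_inj : injective f.
  have fz : f z = E by rewrite /f eqxx.
  move=> i i' ff; have [iz|iz] := eqVneq i z; have [i'z|i'z] := eqVneq i' z.
  - by rewrite iz i'z.
  - by have := sepf i' i'z; rewrite -ff iz fz (negPf (unsep _)).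
  - by have := sepf i iz; rewrite ff i'z fz (negPf (unsep _)).
  have /and3P[/eqP qU iU /existsP[j /andP[jU /eqP eij]]] := sepf i iz.
  have := sepf i' i'z; rewrite -ff.
  move=> /and3P[_ i'U /existsP[j' /andP[j'U /eqP eij']]].
  apply/eqP/negPn/negP => ii'.
  have jj' := mix_unique qU iU jU eij i'U j'U eij' ii'.
  case/eqP: ii'; apply/esym/(mix_sole qU iU jU) => //.
  by rewrite eij jj' eij'.
have eM : f @: setT = [set U : {set 'I_n} | wt U == q].
  apply/eqP; rewrite eqEcard few card_imset // cardsT card_ord leqnn andbT.
  apply/subsetP => _ /imsetP[i _ ->]; rewrite inE.
  have [->|/sepf/and3P[]//] := eqVneq i z.
  by rewrite /f eqxx qE.
have : D \in f @: setT by rewrite eM inE qD.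
case/imsetP => i _ eD; have [iz|/sepf] := eqVneq i z.
  by rewrite eD /f iz eqxx.
rewrite -eD => /and3P[_ iD /existsP[j /andP[jD /eqP eij]]].
by rewrite (unmixD i j) in jD.
Qed.

(** The exchange at [i] removes a nonempty [R]. Its result is not [E]: all kept players of weight 1
    would force weight 1 on [R], which [E] contains. So it separates some [r] from an equal, and [R]
    turns out to be all players no heavier than [r], except [r]. *)
Lemma mix_next (S : {set 'I_n}) i j : wt S = q ->
  i \in S -> j \notin S -> w i = w j -> 1 < w i ->
  exists r, [/\ r \notin S, w r < w i &
    w i + w r = 1 + \sum_(l | w l <= w r) w l].
Proof.
move=> qS iS jS eij i1.
have [R [sR wR wD dR]] := exchange qS iS; set D := _ :\: R in wD dR.
have [E E1 EE] := unmixed_unique.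
have [x xR] : exists x, x \in R.
  by apply/set0Pn; apply/eqP => R0; move: wR; rewrite R0 /coalition_weight big_set0; lia.
have [r [rD [m mD emr]]] : exists r, [/\ r \in D & exists2 m, m \notin D & w r = w m].
  have [|unm] := boolP [exists r, (r \in D) && [exists m, (m \notin D) && (w r == w m)]].
    case/existsP => r /andP[rD /existsP[m /andP[mD /eqP e]]].
    by exists r; split=> //; exists m.
  have DE : D = E.
    apply: EE => // r m erm rD; apply: contraR unm => mD.
    by apply/existsP; exists r; rewrite rD; apply/existsP; exists m; rewrite mD erm /=.
  have pD : p \in D by rewrite DE E1.
  have x1 : w x = 1 by have := dR x p xR pD; have := w_gt0 x; lia.
  by have := E1 x x1; rewrite -DE inE xR.
have outD l : l \notin D -> w l = w r -> l \in R.
  move=> lD elr; apply: contraR lD => lR; rewrite !inE lR /=.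
  have [//|li] := eqVneq l i; apply/negP => lS.
  have sole k : k \in S -> w k = w i -> k = i by apply: (mix_sole qS iS jS).
  have := rD; rewrite !inE => /andP[_ /orP[/eqP ri|rS]].
    by case/eqP: li; apply: sole; rewrite // elr ri.
  have il : i != l by rewrite eq_sym.
  have jr := mix_unique qS iS jS eij lS rS elr il.
  by case/eqP: li; apply: sole; rewrite // elr -jr.
have mR := outD m mD (esym emr).
have ri : w r < w i by rewrite emr -wR addn1 ltnS wt_le.
have rS : r \notin S.
  have := rD; rewrite !inE => /andP[_ /orP[/eqP ei|//]].
  by rewrite ei ltnn in ri.
exists r; split=> //.
(* An equal of [r] is removed by [mix_sole] for [D]. A lighter player is outside [S] by [mix_lower],
   and cannot be kept while the heavier [m] is removed. *)
have eR : R = [set l | w l <= w r] :\ r.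
  apply/setP => l; rewrite !inE; apply/idP/andP => [lR|[lr ll]].
    by split; [apply: contraTneq rD => <-; rewrite !inE lR|apply: dR].
  have [elr|nlr] := eqVneq (w l) (w r).
    apply: outD => //; apply/negP => lD; case/eqP: lr.
    exact: (mix_sole wD rD mD).
  have lr' : w l < w r by rewrite ltn_neqAle nlr.
  have lS : l \notin S.
    by apply: contraL lr' => /(mix_lower qS iS jS eij rS ri); rewrite leqNgt.
  apply: contraT => lR; have := dR m l mR; rewrite !inE lR lS orbT => /(_ isT).
  by rewrite -emr leqNgt lr'.
have -> : \sum_(l | w l <= w r) w l = wt [set l | w l <= w r].
  by apply: eq_bigl => l; rewrite inE.
rewrite -wR (@wtD1 [set l | w l <= w r] r) ?inE // -eR.
by rewrite addnAC addnC [wt R + _]addnC.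
Qed.

(** The last hypothesis says that the recursion at [i] leads to the type just below. A lighter
    player in [S] would belong to that type, which would then be separated along with the type of
    [i]; so [S] lies in the pair of [i] and [z]. *)
Lemma quota_heaviest i j : i != j -> w i = w j ->
  (forall l, l != z -> w l <= w i) ->
  (forall r, w r < w i -> w i + w r = 1 + \sum_(l | w l <= w r) w l ->
    forall l, w l < w i -> w l <= w r) ->
  q = w i + w z.
Proof.
move=> ij eij imax rmax; have [S [qS iS jS]] := mix_exists ij eij.
have iz : i != z := twin_top ij eij.
have sS l : l \in S -> (l == i) || (l == z).
  move=> lS; apply: contraT; rewrite negb_or => /andP[li lz].
  have [eli|nli] := eqVneq (w l) (w i).
    by rewrite (mix_sole qS iS jS eij lS eli) eqxx in li.
  have lti : w l < w i by rewrite ltn_neqAle nli imax.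
  have i1 : 1 < w i by apply: leq_trans lti; rewrite ltnS w_gt0.
  have [r [rS ri er]] := mix_next qS iS jS eij i1.
  have elr : w l = w r.
    by apply/eqP; rewrite eqn_leq (rmax r) // (mix_lower qS iS jS eij rS ri).
  have il : i != l by rewrite eq_sym.
  have jr := mix_unique qS iS jS eij lS rS elr il.
  by rewrite eij jr ltnn in ri.
(* Without [z], player [i] alone would weigh [q], and [i] with its equal [j] would exceed the total
   weight [2 * q - 1]. *)
have zS : z \in S.
  apply: contraT => zS.
  have eS : S = [set i].
    apply/setP => l; rewrite inE; apply/idP/eqP => [lS|->//].
    by have /orP[/eqP//|/eqP lz] := sS l lS; rewrite lz (negPf zS) in lS.
  have wi : wt [set i] = w i by rewrite /coalition_weight big_set1.
  have : wt [set j; i] = q + q by rewrite wtU1 -?eij -?wi -?eS ?qS // eS inE eq_sym.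
  by move: (wtC [set j; i]) quota_gt0 => + + e; rewrite e; lia.
have eS : S = i |: [set z].
  by apply/setP => l; rewrite !inE; apply/idP/orP => [/sS/orP//|[]/eqP->].
by rewrite -qS eS wtU1 ?inE // /coalition_weight big_set1.
Qed.

End HomogeneousGame.

(** * Identities for [k]-Fibonacci numbers *)

Lemma kfibSS k m : kfib k m.+2 = k * kfib k m.+1 + kfib k m.
Proof. by []. Qed.

Lemma kfib_sum k s :
  1 + k * \sum_(u < s.+1) kfib k u.+1 = kfib k s.+2 + kfib k s.+1.
Proof.
elim: s => [|s IH]; first by rewrite big_ord1 /= !addn0 addnC.
rewrite big_ord_recr -[nat_of_ord ord_max]/s.+1 mulnDr addnA IH.
by rewrite [in RHS]kfibSS; lia.
Qed.

(** By [kfib_sum] the recursion reads [a s = kfib k r.+2], which is [a r.+1] if [r.+1 < s];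
    injectivity therefore forces [r.+1 = s]. *)
Lemma kfib_unique k m (a : nat -> nat) : a 0 = 1 ->
  {in gtn m &, injective a} ->
  (forall s, 0 < s < m ->
    exists2 r, r < s & a s + a r = 1 + k * \sum_(u < r.+1) a u) ->
  forall s, s < m -> a s = kfib k s.+1.
Proof.
move=> a0 a_inj rec; elim/ltn_ind => -[//|s] IH sm.
have [r rs] := rec s.+1 sm.
rewrite (eq_bigr (fun u : 'I_r.+1 => kfib k u.+1)); last first.
  by move=> u _; apply: IH; have := ltn_ord u; lia.
rewrite kfib_sum (IH r rs) //; last exact: ltn_trans rs sm.
move=> /addIn er; have [rs'|] := ltnP r.+1 s.+1; last first.
  by rewrite er => sr; have -> : r = s by lia.
have /a_inj : a r.+1 = a s.+1 by rewrite er IH //; apply: ltn_trans rs' sm.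
by rewrite !inE => /(_ (ltn_trans rs' sm) sm); lia.
Qed.

(** * Types indexed from 0 by increasing weight *)

Section TypeWeights.

Variables (n : nat) (w : 'I_n -> nat) (k : nat).
Hypothesis uniform : uniform_types w k.

Local Notation a := (nth 0 (type_weights w)).
Local Notation h := (num_types w).

Lemma type_weights_sorted : sorted ltn (type_weights w).
Proof.
rewrite ltn_sorted_uniq_leq sort_uniq undup_uniq /=.
by apply: sort_sorted => x y; apply: leq_total.
Qed.

Lemma type_weight_le s t : s < h -> t < h -> (a s <= a t) = (s <= t).
Proof.
move=> sh th; have mono x y := sorted_ltn_nth ltn_trans 0 type_weights_sorted x y.
have [st|ts] := leqP s t; last by rewrite leqNgt mono.
by move: st; rewrite leq_eqVlt => /orP[/eqP->|st]; rewrite ?leqnn // ltnW ?mono.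
Qed.

Lemma type_weight_ex l : exists2 s, s < h & w l = a s.
Proof.
have lw : w l \in type_weights w by rewrite mem_sort mem_undup codom_f.
by exists (index (w l) (type_weights w)); rewrite ?nth_index // index_mem.
Qed.

Lemma type_weight_le_pred s l : s.+1 < h ->
  (w l <= a s.+1) = (w l <= a s) || (w l == a s.+1).
Proof.
move=> sh; have [t th ->] := type_weight_ex l.
by rewrite eqn_leq !type_weight_le //; lia.
Qed.

Lemma card_type s : s < h.-1 -> #|[set l | w l == a s]| = k.
Proof.
case: uniform => free _ sh; have sh' : s < h by lia.
have := congr1 (nth 0 ^~ s) free.
by rewrite nth_nseq sh /free_type_representation nth_take // (nth_map 0).
Qed.

(** A general [F] serves both to count players (constant 1) and to add weights (identity). *)
Lemma sum_types (F : nat -> nat) s : s < h.-1 ->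
  \sum_(l | w l <= a s) F (w l) = k * \sum_(u < s.+1) F (a u).
Proof.
have sum1 t : t < h.-1 -> \sum_(l | w l == a t) F (w l) = k * F (a t).
  move=> th; rewrite -(card_type th) -sum_nat_const.
  by apply: eq_big => [l|l /eqP->//]; rewrite inE.
elim: s => [|s IH] sh.
  rewrite big_ord1 /= -sum1 //; apply: eq_bigl => l.
  by have [t th ->] := type_weight_ex l; rewrite eqn_leq !type_weight_le //; lia.
rewrite big_ord_recr /= mulnDr -IH; last by lia.
rewrite -sum1 // (bigID (fun l => w l <= a s)) /=; congr (_ + _).
  apply: eq_bigl => l; rewrite type_weight_le_pred //; last by lia.
  by case: (w l <= a s); rewrite ?andbF.
apply: eq_bigl => l; rewrite type_weight_le_pred //; last by lia.
have [/= ls|] := leqP (w l) (a s); last by rewrite andbT.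
apply/esym/eqP => e; move: ls; rewrite e type_weight_le //; lia.
Qed.

End TypeWeights.

Theorem theorem5p2 (n h k q : nat) (v : simple_game n) (w : 'I_n -> nat)
    (hG : parsimonious v)
    (hrep : minimal_homogeneous_representation v q w)
    (hh : num_types w = h)
    (hk : uniform_types w k) :
  q = kfib k h.
Proof.
case: hG => _ n3 nodummy few; case: hrep => _ [p p1] vE quota homog.
(* Deleting a player of weight 0 keeps a coalition winning, so such a player would be dummy. *)
have w_gt0 i : 0 < w i.
  rewrite lt0n; apply/eqP => wi0; case: (nodummy i) => S minS; apply/negP => iS.
  have /andP[vS /forallP/(_ (S :\ i))] := minS.
  by rewrite properD1 //= !vE; move: vS; rewrite vE (wtD1 w iS) wi0 add0n => ->.
have homogeneous (S : {set 'I_n}) : q <= coalition_weight w S ->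
    (forall i, i \in S -> coalition_weight w (S :\ i) < q) ->
    coalition_weight w S = q.
  move=> qS minS; apply: homog; rewrite /minimal_winning vE qS /=.
  apply/forallP => T; apply/implyP => /properP[sTS [i iS iT]].
  rewrite vE -ltnNge; apply: leq_ltn_trans (minS i iS); apply: wt_subset.
  apply/subsetP => l lT; rewrite !inE (subsetP sTS) // andbT.
  by apply: contraNneq iT => <-.
have minE (S : {set 'I_n}) : minimal_winning v S = (coalition_weight w S == q).
  apply/idP/eqP => [|qS]; first exact: homog.
  rewrite /minimal_winning vE qS leqnn /=.
  apply/forallP => T; apply/implyP => /properP[sTS [i iS iT]].
  rewrite vE -ltnNge -qS (wtD w sTS) -{1}[coalition_weight w T]addn0 ltn_add2l.
  by apply: leq_trans (w_gt0 i) (wt_le w _); rewrite !inE iT.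
have no_dummy i : exists2 S : {set 'I_n}, coalition_weight w S = q & i \in S.
  have [/existsP[S /andP[/eqP qS iS]]|/existsPn noS] :=
    boolP [exists S : {set 'I_n}, (coalition_weight w S == q) && (i \in S)].
    by exists S.
  by case: (nodummy i) => S; rewrite minE => qS; have := noS S; rewrite qS.
have few' : #|[set S : {set 'I_n} | coalition_weight w S == q]| = n.
  by rewrite -[RHS]few; apply: eq_card => S; rewrite !inE minE.
have [_ kh] := hk; rewrite -{}hh; set h' := num_types w in kh *.
pose a := nth 0 (type_weights w).
have h1 : 0 < h'.-1 by case: (h'.-1) kh n3 => // ; rewrite muln0; lia.
have leE s t : s < h' -> t < h' -> (a s <= a t) = (s <= t).
  exact: type_weight_le.
have lth s : s < h'.-1 -> s < h' by lia.
have a_ge1 s : s < h' -> 0 < a s.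
  move=> sh; have : a s \in type_weights w by apply: mem_nth.
  by rewrite mem_sort mem_undup => /codomP[i ->].
have a0 : a 0 = 1.
  have [t th p1t] := type_weight_ex w p; apply/eqP; rewrite eqn_leq a_ge1; last by lia.
  by rewrite -p1 p1t leE //; lia.
have card_a s : s < h'.-1 -> #|[set l | w l == a s]| = k by apply: card_type.
have [p' p'p p'1] := lightest_twin w_gt0 quota homogeneous no_dummy (ltnW (ltnW n3)) p1.
(* Two players of weight 1 exist, and the lightest type has [k] players. *)
have k1 : 1 < k.
  rewrite -(card_a 0) //; apply/card_gt1P; exists p, p'.
  by rewrite !inE p1 p'1 a0 eq_sym.
(* Index [h'.-2] is the second heaviest type. The types up to it hold [k * h'.-1 = n.-1] players,
   which leaves exactly one. *)
have [z zE] : exists z, forall l, (w l <= a h'.-2) = (l != z).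
  have := cardsC [set l | w l <= a h'.-2]; rewrite -sum1_card card_ord.
  under eq_bigl => l do rewrite inE.
  rewrite (sum_types hk (fun=> 1)) -/h'; last by lia.
  rewrite sum_nat_const card_ord muln1 prednK // kh => e.
  have /cards1P[z zE] : #|~: [set l | w l <= a h'.-2]| == 1 by apply/eqP; lia.
  exists z => l; move/setP/(_ l): zE; rewrite !inE.
  by move=> <-; rewrite negbK.
have z_top i : i != z -> w i < w z.
  rewrite -zE => iz; apply: leq_ltn_trans iz _.
  by rewrite ltnNge zE eqxx.
have low i : i != z -> exists2 s, s < h'.-1 & w i = a s.
  have [s sh es] := type_weight_ex w i; rewrite -zE es -/a leE //; last by lia.
  by move=> sh'; exists s => //; lia.
have twin i : i != z -> exists2 j, j != i & w j = w i.
  move=> /low[s sh es]; have : 1 < #|[set l | w l == a s]| by rewrite card_a.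
  rewrite (cardsD1 i) inE es eqxx ltnS => /card_gt0P[j].
  by rewrite !inE => /andP[ji /eqP]; exists j.
have a_inj : {in gtn h'.-1 &, injective a}.
  move=> s t; rewrite !inE => sh th e; apply/eqP.
  by rewrite eqn_leq -(leE s t) -?(leE t s) ?lth // e leqnn.
have pp' : p != p' by rewrite eq_sym.
have rec i : i != z -> 1 < w i ->
    exists r, [/\ w r < w i & w i + w r = 1 + \sum_(l | w l <= w r) w l].
  move=> iz i1; have [j ji eji] := twin i iz; have ij : i != j by rewrite eq_sym.
  have [S [qS iS jS]] := mix_exists w_gt0 quota homogeneous no_dummy ij (esym eji).
  have [r [_ ri er]] := mix_next w_gt0 quota homogeneous no_dummy few' z_top twin
    pp' p1 p'1 qS iS jS (esym eji) i1.
  by exists r.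
have lt_z s r : s < h'.-1 -> w r < a s -> r != z.
  move=> sh rs; rewrite -zE; apply: leq_trans (ltnW rs) _.
  by rewrite leE //; lia.
have a_ex s : s < h'.-1 -> exists2 i, i != z & w i = a s.
  move=> sh; have : 0 < #|[set l | w l == a s]| by rewrite card_a //; lia.
  case/card_gt0P => i; rewrite inE => /eqP ei; exists i => //.
  by rewrite -zE ei leE //; lia.
have a_fib : forall s, s < h'.-1 -> a s = kfib k s.+1.
  apply: kfib_unique => // s /andP[s0 sh]; have [i iz ei] := a_ex s sh.
  have [|r [ri er]] := rec i iz.
    by rewrite ei -a0 ltnNge leE -?ltnNge //; lia.
  have [t th et] := low r (lt_z s r sh (eq_ind _ (leq _) ri _ ei)).
  exists t; first by rewrite ltnNge -leE -?ltnNge -?ei -?et //; lia.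
  by move: er; rewrite ei et (sum_types hk id).
have hm : h'.-2 < h'.-1 by lia.
have [i iz ei] := a_ex _ hm.
have [j ji eji] := twin i iz; have ij : i != j by rewrite eq_sym.
have sumE s : s < h'.-1 ->
    1 + \sum_(l | w l <= a s) w l = kfib k s.+2 + kfib k s.+1.
  move=> sh; rewrite (sum_types hk id) // -kfib_sum; congr (1 + k * _).
  by apply: eq_bigr => u _; apply: a_fib; have := ltn_ord u; lia.
have qE : q = w i + w z.
  apply: (quota_heaviest w_gt0 quota homogeneous no_dummy few' z_top twin pp' p1
    p'1 ij (esym eji)) => [l|r ri er l li].
    by rewrite -zE ei.
  rewrite ei in ri er li.
  have [t th et] := low r (lt_z _ r hm ri).
  have [u uh eu] := low l (lt_z _ l hm li).
  (* The recursion evaluates to [kfib k t.+2], so [r] lies in the type just below that of [i]. *)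
  have eF : a h'.-2 = a t.+1.
    have th' : t < h'.-2 by rewrite ltnNge -leE -?ltnNge -?et //; lia.
    rewrite (a_fib t.+1); last by lia.
    by apply: (@addIn (kfib k t.+1)); rewrite -(sumE t th) -et -er et (a_fib t).
  move: li; rewrite eF et eu ltnNge !leE //; lia.
(* With [w i = kfib k h'.-1], the total weight gives [2 * q = kfib k h' + w i + w z = kfib k h' +
   q]. *)
have : coalition_weight w setT = \sum_(l | w l <= a h'.-2) w l + w z.
  rewrite /coalition_weight (bigD1 z) ?inE //= addnC; congr (_ + _).
  by apply: eq_bigl => l; rewrite inE zE.
have := sumE _ hm; have := a_fib _ hm; rewrite -ei.
have -> : h'.-2.+2 = h' by lia.
by lia.
Qed.
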